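(* Let $f:\mathbb{R}^n\to\mathbb{R}$ be a convex $L$-smooth function for some $L\in(0,\infty)$, and let $x_0\in\mathbb{R}^n$. Let $x:[0,\infty)\to\mathbb{R}^n$ be the unique solution of the gradient flow differential equation $x'(t)=-\nabla f(x(t))$ for $t\ge 0$, $x(0)=x_0$. Then the map $t\mapsto\|\nabla f(x(t))\|$ is non-increasing over $[0,\infty)$.
   Context: A function $f:\mathbb{R}^n\to\mathbb{R}$ is $L$-smooth if it is differentiable and its gradient is $L$-Lipschitz with respect to the Euclidean norm $\|\cdot\|$: $\|\nabla f(x)-\nabla f(y)\|\le L\|x-y\|$ for all $x,y\in\mathbb{R}^n$ (no twice differentiability is assumed). For such $f$, the gradient flow differential equation $x'(t)=-\nabla f(x(t))$, $x(0)=x_0$ has a unique solution on all of $[0,\infty)$ (the derivative at $t=0$ being one-sided), by the Picard–Lindelöf theorem. *)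

(* Defs.v *)
From mathcomp Require Import all_boot all_order all_algebra.
From mathcomp Require Import all_classical all_reals all_analysis.

Set Implicit Arguments.
Unset Strict Implicit.
Unset Printing Implicit Defensive.

Import Order.TTheory GRing.Theory Num.Theory.
Import numFieldNormedType.Exports.

Local Open Scope classical_set_scope.
Local Open Scope ring_scope.

(* The library's norm on 'rV[R]_n is the sup norm, so the Euclidean norm is
   defined here. The topology, and hence differentiability and limits, are the
   same for both norms. *)
Definition enorm {R : realType} {n : nat} (v : 'rV[R]_n) : R :=
  Num.sqrt (\sum_(i < n) v 0 i ^+ 2).

(* The row of partial derivatives; only meaningful where f is differentiable. *)
Definition gradient {R : realType} {n : nat} (f : 'rV[R]_n -> R)
    (x : 'rV[R]_n) : 'rV[R]_n :=
  \row_(i < n) 'D_(delta_mx 0 i) f x.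

Definition L_smooth {R : realType} {n : nat} (L : R) (f : 'rV[R]_n -> R) :
    Prop :=
  (forall x, differentiable f x) /\
  (forall x y, enorm (gradient f x - gradient f y) <= L * enorm (x - y)).

(* A curve on [0, +oo[ is represented by a total function on R whose values at
   negative times are irrelevant: at t = 0 only the right derivative is used. *)
Definition gradient_flow {R : realType} {n : nat} (f : 'rV[R]_n -> R)
    (x0 : 'rV[R]_n) (x : R -> 'rV[R]_n) : Prop :=
  [/\ x 0 = x0,
      h^-1 *: (x h - x 0) @[h --> 0^'+] --> - gradient f (x 0)
    & forall t : R, 0 < t -> is_derive t 1 x (- gradient f (x t))].

(* Main.v *)
(** The flow is autonomous and, since the gradient of a convex function is
    monotone, the Euclidean distance between two of its trajectories is
    non-increasing. Applied to [x] and its time shift [x (. + h)], this makes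
    [|x (t + h) - x t| / h] non-increasing in [t]; letting [h] tend to [0] from
    the right turns this quotient into [|gradient f (x t)|]. *)
Require Import Defs.
From mathcomp Require Import all_boot all_order all_algebra.
From mathcomp Require Import all_classical all_reals all_analysis.
From mathcomp Require Import ring lra.

Import Order.TTheory GRing.Theory Num.Theory.
Import numFieldNormedType.Exports.

Local Open Scope classical_set_scope.
Local Open Scope ring_scope.

Set Implicit Arguments.
Unset Strict Implicit.

(** The differential is linear, so it expands along the basis rows [delta_mx 0 i]. *)
Lemma derive_gradient (R : realType) (n : nat) (f : 'rV[R]_n -> R)
    (a v : 'rV[R]_n) :
  differentiable f a -> 'D_v f a = \sum_(i < n) v 0 i * gradient f a 0 i.
Proof.
move=> df; rewrite deriveE// {1}(row_sum_delta v) linear_sum.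
by apply: eq_bigr => i _; rewrite linearZ /= !mxE deriveE.
Qed.

(** Convexity bounds every difference quotient with step [h] in ]0, 1] by [f b - f a], and the bound
    survives the limit. *)
Lemma convex_derive_le (R : realType) (n : nat) (f : 'rV[R]_n -> R)
    (a b : 'rV[R]_n) :
  @convex_function R 'rV[R]_n setT f -> differentiable f a ->
  'D_(b - a) f a <= f b - f a.
Proof.
move=> cf df.
have /cvg_ex[l fl] := diff_derivable (v := b - a) df.
have -> : 'D_(b - a) f a = l by exact: cvg_lim.
(* Only positive steps make [h *: (b - a) + a] a convex combination, so the two-sided limit is
   restricted to the right. *)
move/cvg_dnbhs_at_right : fl => fl.
rewrite -(cvg_lim _ fl)//.
apply: limr_le; first by apply/cvg_ex; exists l.
near=> h.
have h0 : 0 < h by [].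
have h1 : h <= 1 by near: h; exact: nbhs_right_le.
have ab : h *: (b - a) + a = h *: b + (1 - h) *: a.
  by rewrite scalerBr scalerBl scale1r addrAC addrA.
have := cf (Itv01 (ltW h0) h1) b a (in_setT _) (in_setT _).
rewrite convRE /= {1}/conv /= -ab => fh.
rewrite -[_ *: _]/(h^-1 * (f (h *: (b - a) + a) - f a)) mulrC ler_pdivrMr//.
by move: fh; rewrite /unstable.onem; lra.
Unshelve. all: by end_near. Qed.

(** Add the first-order inequalities at [a] and at [b]: their right-hand sides cancel. *)
Lemma gradient_monotone (R : realType) (n : nat) (f : 'rV[R]_n -> R)
    (a b : 'rV[R]_n) :
  @convex_function R 'rV[R]_n setT f -> (forall x, differentiable f x) ->
  0 <= \sum_(i < n) (a 0 i - b 0 i) * (gradient f a 0 i - gradient f b 0 i).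
Proof.
move=> cf df.
have := lerD (convex_derive_le b cf (df a))
             (convex_derive_le a cf (df b)).
rewrite !derive_gradient// -big_split /= [leRHS](_ : _ = 0); last by ring.
rewrite -oppr_ge0 -sumrN => /le_trans; apply.
by apply: ler_sum => i _; rewrite !mxE; lra.
Qed.

(** Merges the one-sided condition at 0 and the two-sided ones at positive times into a single right
    derivative. *)
Lemma gradient_flow_cvg (R : realType) (n : nat) (f : 'rV[R]_n -> R)
    (x0 : 'rV[R]_n) (x : R -> 'rV[R]_n) (t : R) :
  gradient_flow f x0 x -> 0 <= t ->
  h^-1 *: (x (h + t) - x t) @[h --> 0^'+] --> - gradient f (x t).
Proof.
move=> [_ d0 dt]; rewrite le_eqVlt => /predU1P[<-|t0].
  by under eq_fun do rewrite addr0.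
have [/cvg_ex[l xl] dl] := dt _ t0.
have <- : l = - gradient f (x t) by rewrite -dl; apply/esym/cvg_lim.
move/cvg_dnbhs_at_right : xl.
by under eq_fun do rewrite /GRing.scale /= mulr1.
Qed.

Lemma gradient_flow_right_continuous (R : realType) (n : nat)
    (f : 'rV[R]_n -> R) (x0 : 'rV[R]_n) (x : R -> 'rV[R]_n) (t : R) :
  gradient_flow f x0 x -> 0 <= t -> x (h + t) @[h --> 0^'+] --> x t.
Proof.
move=> gx t0.
(* The quotient converges, so multiplying it by [h] gives 0 in the limit; for nonzero [h] the
   expression is [x (h + t)]. *)
have hx : h *: (h^-1 *: (x (h + t) - x t)) + x t @[h --> 0^'+] --> x t.
  rewrite -[X in _ --> X]add0r -(scale0r (- gradient f (x t))).
  apply: cvgD; last exact: cvg_cst.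
  apply: cvgZ; last exact: gradient_flow_cvg gx t0.
  exact/cvg_at_right_filter/cvg_id.
apply: cvg_trans hx; apply: near_eq_cvg; near=> h.
have h0 : h != 0 by near: h; exact: nbhs_right_neq.
by rewrite scalerA divff// scale1r subrK.
Unshelve. all: by end_near. Qed.

Lemma is_derive_translate (R : realType) (V : normedModType R) (x : R -> V)
    (h t : R) (v : V) :
  is_derive (h + t) 1 x v -> is_derive t (1 : R) (fun s => x (h + s)) v.
Proof.
have shiftE : (fun k : R => k^-1 *: (x (h + (k *: 1 + t)) - x (h + t))) =
              (fun k : R => k^-1 *: (x (k *: 1 + (h + t)) - x (h + t))).
  by apply/funext => k; rewrite addrCA.
by move=> [dx <-]; split; rewrite /derivable /derive /= shiftE.
Qed.

Lemma is_derive_coord (R : realType) (n : nat) (x : R -> 'rV[R]_n)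
    (t : R) (v : 'rV[R]_n) (i : 'I_n) :
  is_derive t 1 x v -> is_derive t (1 : R) (fun s => x s 0 i) (v 0 i).
Proof.
move=> [dx <-]; split; first exact: (derivable_mxP _ _ _).1 dx 0 i.
by rewrite derive_mx// mxE.
Qed.

Lemma sum_sqr_continuous (R : realType) (n : nat) :
  continuous (fun v : 'rV[R]_n => \sum_(i < n) v 0 i ^+ 2).
Proof.
apply: continuous_big => [|i _ v]; first exact: add_continuous.
apply: (@continuous_comp 'rV[R]_n R R (fun v => v 0 i) (fun y => y ^+ 2)).
  exact: coord_continuous.
exact: exprn_continuous.
Qed.

(** Transfers limits in the sup-norm topology of rows to Euclidean norms. *)
Lemma enorm_continuous (R : realType) (n : nat) : continuous (@enorm R n).
Proof.
move=> v; apply: continuous_comp; first exact: sum_sqr_continuous.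
exact: sqrt_continuous.
Qed.

Lemma enormZ (R : realType) (n : nat) (k : R) (v : 'rV[R]_n) :
  0 <= k -> enorm (k *: v) = k * enorm v.
Proof.
move=> k0; rewrite /enorm.
under eq_bigr do rewrite mxE exprMn.
by rewrite -mulr_sumr sqrtrM ?sqr_ge0// sqrtr_sqr ger0_norm.
Qed.

Lemma enormN (R : realType) (n : nat) (v : 'rV[R]_n) : enorm (- v) = enorm v.
Proof. by congr Num.sqrt; apply: eq_bigr => i _; rewrite mxE sqrrN. Qed.

Lemma gradient_flow_shift_nonincreasing (R : realType) (n : nat)
    (f : 'rV[R]_n -> R) (x0 : 'rV[R]_n) (x : R -> 'rV[R]_n) (h s t : R) :
  @convex_function R 'rV[R]_n setT f -> (forall x, differentiable f x) ->
  gradient_flow f x0 x -> 0 <= h -> 0 <= s -> s <= t ->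
  enorm (x (h + t) - x t) <= enorm (x (h + s) - x s).
Proof.
(* Squared distances are compared because, unlike the norm, the square is differentiable even where
   it vanishes. *)
move=> cf df gx h0 s0 st; apply: ler_wsqrtr.
pose D (i : 'I_n) : R -> R := (fun u => x (h + u) 0 i) - (fun u => x u 0 i).
pose phi : R -> R := \sum_(i < n) (D i ^+ 2).
have phiE u : phi u = \sum_(i < n) (x (h + u) - x u) 0 i ^+ 2.
  by rewrite /phi fct_sumE; apply: eq_bigr => i _; rewrite fctE !mxE.
rewrite -!phiE.
pose G (u : R) i := gradient f (x (h + u)) 0 i - gradient f (x u) 0 i.
have dphi (u : R) : 0 < u ->
    is_derive u 1 phi (\sum_(i < n) (2%:R * D i u ^+ 1) *: (- G u i)).
  move=> u0; have [_ _ dx] := gx.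
  have dD i : is_derive u (1 : R) (D i) (- G u i).
    have dhu := is_derive_coord i
      (is_derive_translate (dx (h + u) (ltr_wpDl h0 u0))).
    have du := is_derive_coord i (dx u u0).
    have <- : (- gradient f (x (h + u))) 0 i - (- gradient f (x u)) 0 i =
              - G u i by rewrite /G [in LHS]mxE [in X in _ - X]mxE; ring.
    exact: is_deriveB.
  by apply: is_derive_sum => i; exact: is_deriveX.
apply: (@ler0_derive1_nincry _ _ 0) => //.
- by move=> u; rewrite in_itv/= andbT => /dphi[].
- move=> u; rewrite in_itv/= andbT => u0.
  rewrite derive1E; have [_ ->] := dphi _ u0.
  (* The derivative of [phi] is -2 times the sum that monotonicity of the gradient makes
     nonnegative. *)
  have := gradient_monotone (x (h + u)) (x u) cf df.
  have -> : \sum_(i < n) (2%:R * D i u ^+ 1) *: (- G u i) =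
            - (2 * \sum_(i < n) D i u * G u i).
    rewrite mulr_sumr -sumrN; apply: eq_bigr => i _.
    by rewrite expr1 /GRing.scale /=; ring.
  by rewrite oppr_le0 => ?; rewrite mulr_ge0.
(* Derivatives are known at positive times only; including the endpoint 0 takes right continuity of
   [phi] there. *)
- apply/continuous_within_itvcyP; split.
    move=> u; rewrite in_itv/= andbT => /dphi[du _].
    exact/differentiable_continuous/derivable1_diffP.
  rewrite (funext phiE) /=.
  apply: (continuous_cvg _ (@sum_sqr_continuous _ _ _)); apply: cvgB.
    under eq_fun do rewrite addrC.
    by rewrite addr0; exact: gradient_flow_right_continuous gx h0.
  have := gradient_flow_right_continuous gx (lexx 0).
  by under eq_fun do rewrite addr0.
Qed.

Unset Implicit Arguments.
Set Strict Implicit.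

Theorem theorem6 (R : realType) (n : nat) (f : 'rV[R]_n -> R) (L : R)
    (x0 : 'rV[R]_n) (x : R -> 'rV[R]_n) :
  0 < L ->
  @convex_function R 'rV[R]_n setT f ->
  L_smooth L f ->
  gradient_flow f x0 x ->
  {in `[0, +oo[ &, nonincreasing_fun (fun t : R => enorm (gradient f (x t)))}.
Proof.
move=> _ cf [df _] gx s t; rewrite !in_itv/= !andbT => s0 t0 st.
have lim u : 0 <= u ->
    enorm (h^-1 *: (x (h + u) - x u)) @[h --> 0^'+] --> enorm (gradient f (x u)).
  move=> u0; rewrite -enormN.
  exact: continuous_cvg (@enorm_continuous _ _ _) (gradient_flow_cvg gx u0).
(* It suffices to compare the quotients at [t] and [s] for each small [h > 0], where the common
   factor [h^-1] drops out. *)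
apply: ler_cvg_to (lim t t0) (lim s s0) _; near=> h.
have h0 : 0 <= h by [].
rewrite !enormZ ?invr_ge0// ler_wpM2l ?invr_ge0//.
exact: gradient_flow_shift_nonincreasing gx h0 s0 st.
Unshelve. all: by end_near. Qed.
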